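(* Let $F_{4,2}$ be the $3$-graph on vertex set $\{1,\dots,6\}$ with edges $\{123, 124, 134, 156, 256, 356, 456\}$. Then $\gamma^+(F_{4,2}) = \frac{3}{5}$.
   Context: For a $3$-graph $H$, the minimum positive co-degree $\delta_2^+(H)$ is the largest $k$ such that every pair of vertices contained in some edge of $H$ is contained in at least $k$ edges (it is $0$ for the edgeless graph). For a $3$-graph $F$, $\mathrm{co^+ex}(n,F)$ is the maximum of $\delta_2^+(H)$ over $n$-vertex $3$-graphs $H$ not containing $F$ as a (not necessarily induced) subhypergraph, and $\gamma^+(F)=\lim_{n\to\infty}\mathrm{co^+ex}(n,F)/n$ (the limit exists). *)

(* Defs.v *)
From HB Require Import structures.
From mathcomp Require Import all_boot all_order all_algebra.
From mathcomp Require Import all_classical all_reals all_analysis.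

Set Implicit Arguments.
Unset Strict Implicit.
Unset Printing Implicit Defensive.

Import Order.TTheory GRing.Theory Num.Theory.
Import numFieldNormedType.Exports.

Record three_graph (V : finType) := ThreeGraph {
  edges : {set {set V}};
  edges_card3 : [forall e in edges, #|e| == 3] }.

HB.instance Definition _ (V : finType) := [isSub for @edges V].
HB.instance Definition _ (V : finType) := [Finite of three_graph V by <:].

Definition codeg (V : finType) (H : three_graph V) (P : {set V}) : nat :=
  #|[set e in edges H | P \subset e]|.

Definition pos_codeg_ge (V : finType) (H : three_graph V) (k : nat) : bool :=
  [forall P : {set V},
     (#|P| == 2) && [exists e in edges H, P \subset e] ==> (k <= codeg H P)].

(* The bound on [k] only makes the maximum finite: if [H] has an edge, then
   [pos_codeg_ge H k] forces [k <= #|edges H|], as it bounds some co-degree.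
   If [H] is edgeless, only [k = 0] is in range, so that the value is 0. *)
Definition min_pos_codeg (V : finType) (H : three_graph V) : nat :=
  \max_(k < #|edges H|.+1 | pos_codeg_ge H k) k.

Definition contains_copy (W V : finType) (F : three_graph W)
    (H : three_graph V) : bool :=
  [exists f : {ffun W -> V},
     injectiveb f && [forall e in edges F, f @: e \in edges H]].

Definition co_ex_plus (n : nat) (W : finType) (F : three_graph W) : nat :=
  \max_(H : three_graph 'I_n | ~~ contains_copy F H) min_pos_codeg H.

Definition co_ex_plus_ratio (R : realType) (W : finType) (F : three_graph W)
    : nat -> R :=
  fun n => ((co_ex_plus n F)%:R / n%:R)%R.

Definition gamma_plus (R : realType) (W : finType) (F : three_graph W) : R :=
  limn (co_ex_plus_ratio R F).

(* The vertex labelled [i] in 1..6 is the element [i - 1] of ['I_6]. *)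
Definition F42_edges : {set {set 'I_6}} :=
  [set:: [seq [set v : 'I_6 | v.+1 \in t]
         | t <- [:: [:: 1; 2; 3]; [:: 1; 2; 4]; [:: 1; 3; 4];
                    [:: 1; 5; 6]; [:: 2; 5; 6]; [:: 3; 5; 6]; [:: 4; 5; 6]]]].

Lemma F42_edges_card3 : [forall e in F42_edges, #|e| == 3].
Proof.
apply/forall_inP => e; rewrite inE => /mapP[t t_in ->].
move: t t_in; apply/allP; rewrite /= !cardsE -!sum1_card.
by rewrite ![\sum_(_ in _) 1]big_mkcond !big_ord_recl !big_ord0.
Qed.

Definition F42 : three_graph 'I_6 := ThreeGraph F42_edges_card3.

(* Main.v *)
(** Upper bound: let [5 k > 3 n], let every positive pair have at least [k]
    neighbours, and let [S] be the neighbourhood of a positive pair [u v].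
    For [s] in [S] the neighbourhood of [u s] meets [S], say in [t]; as [s t] is
    then positive, its neighbourhood meets [S] as well, so [S] contains an edge
    [x y z].  Each of the pairs [x y], [x z], [y z] has at least [k + |S| - n]
    neighbours in [S], and three times this exceeds [|S|], so two of these
    neighbourhoods share a vertex [w] of [S].  Then [x, y, z, w] span three edges
    inside the neighbourhood of [u v], which gives a copy of [F_{4,2}].

    Lower bound: every two vertices of [F_{4,2}] lie in a common edge, so it has
    no copy in the balanced complete 5-partite 3-graph. *)

Require Import Defs.
From mathcomp Require Import all_boot all_order all_algebra.
From mathcomp Require Import all_classical all_reals all_analysis.
From mathcomp Require Import zify lra.

Import Order.TTheory GRing.Theory Num.Theory.
Import numFieldNormedType.Exports.

Set Implicit Arguments.
Unset Strict Implicit.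
Unset Printing Implicit Defensive.

(** * Three-element sets *)

Lemma set3_rot (T : finType) (a b c : T) : [set a; b; c] = [set b; c; a].
Proof. by apply/setP => x; rewrite !inE -orbA orbC. Qed.

Lemma set3_swap (T : finType) (a b c : T) : [set a; b; c] = [set b; a; c].
Proof. by rewrite [[set a; b]]finset.setUC. Qed.

Lemma cards3_uniq (T : finType) (a b c : T) :
  (#|[set a; b; c]| == 3) = uniq [:: a; b; c].
Proof.
have -> : #|[set a; b; c]| = #|[:: a; b; c]|.
  by apply: eq_card => x; rewrite !inE orbA.
by apply/eqP/card_uniqP.
Qed.

(** * Neighbourhoods of pairs and positive co-degree *)

Section Neighbourhoods.

Variables (V : finType) (H : three_graph V).
Implicit Types a b c d u v w : V.

(** Edges have three elements, so neither [u] nor [v] belongs to this set, and it is empty when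
    [u = v]. *)
Definition nbh u v : {set V} := [set w | [set u; v; w] \in edges H].

Lemma in_nbh u v w : (w \in nbh u v) = ([set u; v; w] \in edges H).
Proof. by rewrite inE. Qed.

Lemma edge_card3 (e : {set V}) : e \in edges H -> #|e| = 3.
Proof. by move=> eH; apply/eqP; apply: (forall_inP (edges_card3 H)). Qed.

Lemma edge_uniq a b c : [set a; b; c] \in edges H -> uniq [:: a; b; c].
Proof.
by rewrite -cards3_uniq => /edge_card3->.
Qed.

Lemma edge_sup_pair (e : {set V}) u v : e \in edges H -> u != v ->
  [set u; v] \subset e -> exists2 w, w \in nbh u v & e = [set u; v; w].
Proof.
move=> eH uv uve.
have : #|e :\: [set u; v]| = 1.
  by rewrite cardsD (finset.setIidPr uve) cards2 uv (edge_card3 eH).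
move/eqP/cards1P => [w ew].
have ee : e = [set u; v; w] by rewrite -(finset.setID e [set u; v]) ew (finset.setIidPr uve).
by exists w => //; rewrite in_nbh -ee.
Qed.

Lemma codeg_nbh u v : u != v -> codeg H [set u; v] = #|nbh u v|.
Proof.
move=> uv; rewrite /codeg -(@card_in_imset _ _ (fun w => [set u; v; w])).
  apply: eq_card => e; rewrite inE; apply/andP/imsetP.
    by case=> eH; exact: edge_sup_pair.
  by case=> w; rewrite in_nbh => h ->; split=> //; apply: finset.subsetUl.
move=> w w'; rewrite !in_nbh => /edge_uniq + _ /setP/(_ w).
rewrite !inE eqxx orbT => /= /and3P[/norP[_]].
rewrite !inE => uw vw _ /esym; rewrite (eq_sym w u) (eq_sym w v).
by move: uw; rewrite (negPf vw); case: (u == w) => //= _ /eqP.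
Qed.

Lemma pos_codeg_geP k : reflect
  (forall a b c, [set a; b; c] \in edges H -> k <= #|nbh a b|)
  (pos_codeg_ge H k).
Proof.
apply: (iffP forallP) => [h a b c eH | h P].
  have := edge_uniq eH; rewrite /= !inE => /andP[/norP[ab _] _].
  rewrite -codeg_nbh //; apply: (implyP (h _)); rewrite cards2 ab /=.
  by apply/existsP; exists [set a; b; c]; rewrite eH finset.subsetUl.
apply/implyP => /andP[/cards2P[u [v [uv ->]]] /exists_inP[e eH uve]].
have [w] := edge_sup_pair eH uv uve; rewrite in_nbh => /h.
by rewrite codeg_nbh.
Qed.

(** The maximum only ranges over values up to the number of edges; the edge keeps [k] in range,
    since [k] is at most the co-degree of [a b]. *)
Lemma pos_codeg_ge_le_min k a b c :
  pos_codeg_ge H k -> [set a; b; c] \in edges H -> k <= min_pos_codeg H.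
Proof.
move=> hk eH.
have ab : a != b by have := edge_uniq eH; rewrite /= !inE => /andP[/norP[]].
have k_lt : k < #|edges H|.+1.
  rewrite ltnS; apply: leq_trans (_ : codeg H [set a; b] <= _).
    by rewrite codeg_nbh //; exact: (pos_codeg_geP _ hk _ _ _ eH).
  by apply/subset_leq_card/fintype.subsetP => e; rewrite inE => /andP[].
exact: (@leq_bigmax_cond _ _ _ (Ordinal k_lt)).
Qed.

(** The value 0 satisfies any bound, and a positive [k] in the range of the maximum forces an edge
    to exist. *)
Lemma min_pos_codeg_le m :
  (forall k a b c, pos_codeg_ge H k -> [set a; b; c] \in edges H -> k <= m) ->
  min_pos_codeg H <= m.
Proof.
move=> hm; apply/bigmax_leqP => k hk.
have [/eqP-> // | ] := boolP (k == 0 :> nat).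
rewrite -lt0n => k_gt0.
have /card_gt0P[e eH] : 0 < #|edges H| by rewrite (leq_trans k_gt0) // -ltnS.
have /card_gt2P[a [b [c [[ae be _] [ab _ _]]]]] : 2 < #|e| by rewrite edge_card3.
have [] := @edge_sup_pair e a b eH ab.
  by apply/fintype.subsetP => x; rewrite !inE => /orP[]/eqP->.
by move=> w; rewrite in_nbh => /hm + _; apply.
Qed.

(** * Upper bound: forcing a copy of [F42] *)

Lemma card_gt_meet (A B : {set V}) :
  #|V| < #|A| + #|B| -> exists2 x, x \in A & x \in B.
Proof.
move=> lt_AB; suff /set0Pn[x] : A :&: B != finset.set0.
  by rewrite inE => /andP[xA xB]; exists x.
rewrite -card_gt0; have : #|A :|: B| <= #|V| := max_card _; have := cardsUI A B; lia.
Qed.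

Lemma card_gt_meet3 (S A B C : {set V}) :
    A \subset S -> B \subset S -> C \subset S -> #|S| < #|A| + #|B| + #|C| ->
  exists2 x, x \in S &
    [|| (x \in A) && (x \in B), (x \in A) && (x \in C) | (x \in B) && (x \in C)].
Proof.
move=> AS BS CS lt_ABC.
suff /set0Pn[x] : (A :&: B) :|: ((A :|: B) :&: C) != finset.set0.
  rewrite !inE => hx; exists x.
    case/orP: hx => /andP[]; first by move/(fintype.subsetP AS).
    by move=> _ /(fintype.subsetP CS).
  by case/orP: hx => [-> // | /andP[/orP[]-> ->]]; rewrite ?orbT.
(* Inclusion-exclusion twice: the three sizes add up to that of the triple union, at most [#|S|],
   plus those of the two intersections here. *)
rewrite -card_gt0.
have := cardsUI A B; have := cardsUI (A :|: B) C.
have := subset_leq_card (finset.subsetUl (A :&: B) ((A :|: B) :&: C)).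
have := subset_leq_card (finset.subsetUr (A :&: B) ((A :|: B) :&: C)).
have : #|A :|: B :|: C| <= #|S| by rewrite subset_leq_card // !finset.subUset AS BS.
lia.
Qed.

Lemma nbh_edge k u v w :
    pos_codeg_ge H k -> #|V| < k.*2 -> [set u; v; w] \in edges H ->
  exists x y z, [/\ x \in nbh u v, y \in nbh u v, z \in nbh u v
                 & [set x; y; z] \in edges H].
Proof.
move=> /pos_codeg_geP hk ltVk uvw.
have meet a b c a' b' c' : [set a; b; c] \in edges H ->
    [set a'; b'; c'] \in edges H -> exists2 x, x \in nbh a b & x \in nbh a' b'.
  by move=> /hk ? /hk ?; apply: card_gt_meet; lia.
have uwv : [set u; w; v] \in edges H by rewrite set3_swap set3_rot.
have [t tv tw] := meet _ _ _ _ _ _ uvw uwv.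
have wtu : [set w; t; u] \in edges H by rewrite -set3_rot -in_nbh.
have [z zS zwt] := meet _ _ _ _ _ _ uvw wtu.
by exists w, t, z; rewrite -in_nbh; split; rewrite // in_nbh.
Qed.

(** The vertices 1, ..., 6 go to [a, b, c, d, u, v]; in particular [a] is the vertex common to the
    three edges inside the neighbourhood of [u v]. *)
Lemma contains_F42 a b c d u v :
    [set a; b; c] \in edges H -> [set a; b; d] \in edges H ->
    [set a; c; d] \in edges H ->
    a \in nbh u v -> b \in nbh u v -> c \in nbh u v -> d \in nbh u v ->
  contains_copy F42 H.
Proof.
rewrite !in_nbh => abc abd acd auv buv cuv duv.
pose s := [:: a; b; c; d; u; v].
(* Any two of the six vertices lie in one of the seven edges, hence differ. *)
have s_uniq : uniq s.
  move: (edge_uniq abc) (edge_uniq abd) (edge_uniq acd).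
  move: (edge_uniq auv) (edge_uniq buv) (edge_uniq cuv) (edge_uniq duv).
  rewrite /s /= !inE !negb_or !andbT (eq_sym u a) (eq_sym v a) (eq_sym u b).
  rewrite (eq_sym v b) (eq_sym u c) (eq_sym v c) (eq_sym u d) (eq_sym v d).
  do 7![case/andP=> /andP[? ?] ?].
  by repeat (apply/andP; split).
apply/existsP; exists [ffun i : 'I_6 => nth a s i]; apply/andP; split.
  apply/injectiveP => i j; rewrite !ffunE => /eqP.
  by rewrite nth_uniq // => /eqP/val_inj.
have imE i j k : i < 6 -> j < 6 -> k < 6 ->
    [ffun i : 'I_6 => nth a s i] @: [set x : 'I_6 | x.+1 \in [:: i.+1; j.+1; k.+1]]
    = [set nth a s i; nth a s j; nth a s k].
  move=> i6 j6 k6.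
  have -> : [set x : 'I_6 | x.+1 \in [:: i.+1; j.+1; k.+1]] =
      [set Ordinal i6; Ordinal j6; Ordinal k6].
    by apply/setP => x; rewrite !inE !eqSS orbA.
  by rewrite !imsetU !imset_set1 !ffunE.
apply/forall_inP => e; rewrite inE => /mapP[t t_in ->].
move: t t_in; apply/allP; rewrite /= !imE //= abc abd acd /=.
by rewrite !(set3_rot _ u v) auv buv cuv duv.
Qed.

Lemma contains_F42_of_codeg k a b c :
    pos_codeg_ge H k -> 3 * #|V| < 5 * k -> [set a; b; c] \in edges H ->
  contains_copy F42 H.
Proof.
move=> hk ltVk abc.
have [|x [y [z [xS yS zS xyz]]]] := nbh_edge hk _ abc; first lia.
move/pos_codeg_geP: hk => hk; have Sk := hk _ _ _ abc.
set S := nbh a b in xS yS zS Sk.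
have cardI p q r : [set p; q; r] \in edges H -> k + #|S| <= #|nbh p q :&: S| + #|V|.
  move=> /hk; have : #|nbh p q :|: S| <= #|V| := max_card _.
  have := cardsUI (nbh p q) S; lia.
have yzx : [set y; z; x] \in edges H by rewrite -set3_rot.
have zxy : [set z; x; y] \in edges H by rewrite -set3_rot.
have := cardI _ _ _ xyz; have := cardI _ _ _ yzx; have := cardI _ _ _ zxy.
move=> hzx hyz hxy.
(* The sizes add up to at least [3 * (k + #|S| - #|V|)], which exceeds [#|S|] because [#|S| >= k]
   and [5 * k > 3 * #|V|]. *)
have [| | | |w wS] := @card_gt_meet3 S (nbh x y :&: S) (nbh y z :&: S) (nbh z x :&: S);
  rewrite ?finset.subsetIr //; first lia.
rewrite !(inE, wS) !andbT => /or3P[] /andP[h1 h2].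
(* In each case the vertex shared by the two pairs whose neighbourhoods contain [w] plays vertex
   1. *)
- by apply: (@contains_F42 y z x w a b) => //; rewrite set3_swap.
- by apply: (@contains_F42 x y z w a b) => //; rewrite set3_swap.
- by apply: (@contains_F42 z x y w a b) => //; rewrite set3_swap.
Qed.

End Neighbourhoods.

(** * Lower bound: complete multipartite 3-graphs *)

Section Rainbow.

Variables (V K : finType) (c : V -> K).

(** The complete multipartite 3-graph whose parts are the fibres of [c]: an edge is a triple on
    which [c] is injective. *)
Definition rainbow_edges : {set {set V}} :=
  [set e : {set V} | (#|e| == 3) && (#|c @: e| == 3)].

Lemma rainbow_edges_card3 : [forall e in rainbow_edges, #|e| == 3].
Proof. by apply/forall_inP => e; rewrite inE => /andP[]. Qed.

Definition rainbow : three_graph V := ThreeGraph rainbow_edges_card3.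

Lemma in_rainbow x y z :
  ([set x; y; z] \in edges rainbow) = uniq [:: c x; c y; c z].
Proof.
rewrite inE !imsetU !imset_set1 !cards3_uniq andb_idl // => h.
by apply: (@map_uniq _ _ c).
Qed.

Lemma F42_covers_pairs (i j : 'I_6) :
  exists2 e, e \in F42_edges & (i \in e) && (j \in e).
Proof.
have : has (fun t => (i.+1 \in t) && (j.+1 \in t))
  [:: [:: 1; 2; 3]; [:: 1; 2; 4]; [:: 1; 3; 4];
      [:: 1; 5; 6]; [:: 2; 5; 6]; [:: 3; 5; 6]; [:: 4; 5; 6]].
  by case: i j => [[|[|[|[|[|[|]]]]]] //= _] [[|[|[|[|[|[|]]]]]] //= _].
case/hasP => t t_in ijt; exists [set x : 'I_6 | x.+1 \in t]; last by rewrite !inE.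
by rewrite inE; apply: map_f.
Qed.

Lemma rainbow_F42_free : #|K| < 6 -> ~~ contains_copy F42 rainbow.
Proof.
apply: contraL => /existsP[f /andP[/injectiveP f_inj /forall_inP f_edge]].
(* The colouring is injective on each edge of the copy, and these edges cover all pairs, so the six
   vertices get distinct colours. *)
rewrite -leqNgt -[6]card_ord; apply: (@leq_card _ _ (c \o f)) => i j.
have [e eF /andP[ie je]] := F42_covers_pairs i j.
have := f_edge e eF; rewrite inE => /andP[/eqP card_fe /eqP card_cfe] /= cfij.
have /imset_injP c_inj : #|c @: (f @: e)| == #|f @: e| by rewrite card_fe card_cfe.
by apply/f_inj/c_inj; rewrite ?imset_f.
Qed.

(** The neighbourhood of a positive pair is the complement of its two colour classes. *)
Lemma rainbow_pos_codeg_ge m : (forall k, #|[set x | c x == k]| <= m) ->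
  pos_codeg_ge rainbow (#|V| - m.*2).
Proof.
move=> hm; apply/pos_codeg_geP => x y z; rewrite in_rainbow /= !inE.
case/andP => /norP[xy _] _; rewrite leq_subLR.
have -> : nbh rainbow x y = ~: ([set w | c w == c x] :|: [set w | c w == c y]).
  apply/setP => w; rewrite in_nbh in_rainbow /= !inE (negPf xy) /= andbT.
  by rewrite negb_or (eq_sym (c w)) (eq_sym (c w)).
rewrite -(cardsC ([set w | c w == c x] :|: [set w | c w == c y])) leq_add2r.
by rewrite -addnn cardsU (leq_trans (leq_subr _ _)) // leq_add.
Qed.

End Rainbow.

Definition mod5 n (i : 'I_n) : 'I_5 := Ordinal (ltn_pmod i (isT : 0 < 5)).

Lemma card_mod5_fiber n (k : 'I_5) : #|[set i : 'I_n | mod5 i == k]| <= (n %/ 5).+1.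
Proof.
rewrite -[leqRHS]card_ord.
(* Within a residue class, [i] is determined by its quotient [i %/ 5], which is at most [n %/ 5]. *)
rewrite -(@card_in_imset _ _ (fun i : 'I_n => inord (i %/ 5) : 'I_(n %/ 5).+1)).
  exact: max_card.
move=> i j; rewrite !inE => /eqP <- /eqP/(congr1 val)/= ij_mod.
move=> /(congr1 val); rewrite /= !inordK ?ltnS ?leq_div2r 1?ltnW //.
by move=> ij_div; apply: val_inj; rewrite /= (divn_eq i 5) (divn_eq j 5) ij_div ij_mod.
Qed.

(** * The bounds for each [n] and the limit *)

Lemma co_ex_plus_F42_le n : 5 * co_ex_plus n F42 <= 3 * n.
Proof.
rewrite mulnC -leq_divRL //; apply/bigmax_leqP => H F42_free.
apply: min_pos_codeg_le => k a b c hk abc; rewrite leq_divRL // leqNgt.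
apply: contra F42_free => ltk.
by apply: contains_F42_of_codeg hk _ abc; rewrite card_ord mulnC [ltnRHS]mulnC // mulnC.
Qed.

Lemma co_ex_plus_F42_ge n : 3 <= n -> 3 * n <= 5 * co_ex_plus n F42 + 10.
Proof.
move=> n3; suff : n - (n %/ 5).+1.*2 <= co_ex_plus n F42 by lia.
have F42_free : ~~ contains_copy F42 (rainbow (@mod5 n)).
  by apply: rainbow_F42_free; rewrite card_ord.
apply: leq_trans (@leq_bigmax_cond _ (fun H => ~~ contains_copy F42 H) _ _ F42_free).
have n0 : 0 < n by lia.
have n1 : 1 < n by lia.
apply: (@pos_codeg_ge_le_min _ _ _ (Ordinal n0) (Ordinal n1) (Ordinal n3)).
  by rewrite -[n in n - _]card_ord; apply: rainbow_pos_codeg_ge (@card_mod5_fiber n).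
by rewrite in_rainbow.
Qed.

Theorem theorem2p5 (R : realType) :
  cvgn (co_ex_plus_ratio R F42) /\ gamma_plus R F42 = (3%:R / 5%:R)%R.
Proof.
suff lim35 : (co_ex_plus_ratio R F42 @ \oo --> (3%:R / 5%:R : R)%R)%classic.
  by split; [apply/cvg_ex; exists (3%:R / 5%:R)%R | apply/cvg_lim].
apply/cvgrPdist_le => e e_gt0; near=> n.
have n3 : 3 <= n by near: n; exact: nbhs_infty_ge.
have n_gt0 : (0 < n%:R :> R)%R by rewrite ltr0n; lia.
(* The lower bound reads [m / n >= 3 / 5 - 2 / n], so the error is at most [e] from here on. *)
have en : (2 / e <= n%:R)%R by near: n; exact: nbhs_infty_ger.
have := co_ex_plus_F42_le n; have := co_ex_plus_F42_ge n3.
rewrite /co_ex_plus_ratio; move: (co_ex_plus n F42) => m.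
rewrite -!(ler_nat R) natrD !natrM => lo up.
rewrite ler_pdivrMr // in en.
have up_div : (m%:R / n%:R <= 3 / 5 :> R)%R by rewrite ler_pdivrMr //; lra.
have lo_div : (3 / 5 - e <= m%:R / n%:R :> R)%R by rewrite ler_pdivlMr //; lra.
by rewrite ler_distl; apply/andP; split; lra.
Unshelve. all: by end_near.
Qed.
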